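(* Let $G$ be a finite group and $p$ a prime dividing $|G|$. Let $c$ be the number of conjugacy classes of the group $\langle G_p\rangle$ consisting of $p$-power order elements (i.e. contained in $G_p$). Then $$\Delta(\overline{\mathcal{R}(G_p)})\simeq S^{c-2}*\Delta(\mathcal{P}(G_p)).$$
   Context: $G_p$ is the set of elements of $G$ whose order is a power of $p$, viewed as a rack under $a\triangleright b=aba^{-1}$. $\mathcal{R}(G_p)$ is its lattice of subracks (subsets closed under $\triangleright$, including $\emptyset$), $\overline{\mathcal{R}(G_p)}=\mathcal{R}(G_p)\setminus\{G_p,\emptyset\}$, and $\mathsf{Inf}(\mathcal{R}(G_p))$ is the subposet of $\overline{\mathcal{R}(G_p)}$ of intersections of sets of maximal proper subracks. $\mathsf{Inn}(G_p)$ is the group generated by the conjugation maps by elements of $G_p$. Spherical subracks: $\mathcal{S}(X)=\{S\in\mathsf{Inf}(\mathcal{R}(X)): S$ is a union of $\mathsf{Inn}(X)$-orbits$\}$; parabolic subracks: $\mathcal{P}(X)=\{P\in\mathsf{Inf}(\mathcal{R}(X)): P\cap S\neq\emptyset$ for all $S\in\mathcal{S}(X)\}$, ordered by inclusion. $\Delta$ is the order complex, $*$ the join, $S^k$ the $k$-sphere ($S^{-1}=\emptyset$), and $\simeq$ homotopy equivalence. *)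

(* Defs.v *)
From HB Require Import structures.
From mathcomp Require Import all_boot all_order all_algebra all_fingroup all_solvable.
Set Implicit Arguments. Unset Strict Implicit. Unset Printing Implicit Defensive.
Import Order.TTheory GRing.Theory Num.Theory.

Section Racks.
Variable gT : finGroupType.
Local Open Scope group_scope.

Definition Gp (G : {set gT}) (p : nat) : {set gT} := [set x in G | p.-elt x].

(* subracks of the rack X (a conjugation-closed subset of a group) under
   a |> b = a b a^-1 ; note  b ^ a^-1 = a b a^-1  in MathComp. *)
Definition is_subrack (X S : {set gT}) : bool :=
  (S \subset X) && [forall a in S, forall b in S, (b ^ a^-1) \in S].

Definition subracks (X : {set gT}) : {set {set gT}} :=
  [set S : {set gT} | is_subrack X S].

Definition Rbar (X : {set gT}) : {set {set gT}} :=
  subracks X :\: [set X; set0].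

Definition max_proper_subrack (X M : {set gT}) : bool :=
  maxset (fun S : {set gT} => is_subrack X S && (S != X)) M.

Definition InfR (X : {set gT}) : {set {set gT}} :=
  [set S in Rbar X | [exists F : {set {set gT}},
     [&& F != set0, [forall M in F, max_proper_subrack X M]
       & S == \bigcap_(M in F) M]]].

(* Inn(X): the group generated by the conjugation maps b |-> a b a^-1, a in X,
   realised as permutations of gT (they restrict to permutations of X) *)
Definition Inn (X : {set gT}) : {set {perm gT}} :=
  <<[set actperm 'J a^-1 | a in X]>>.

Definition union_of_Inn_orbits (X S : {set gT}) : bool :=
  [forall x in S, orbit 'P (Inn X) x \subset S].

Definition Spherical (X : {set gT}) : {set {set gT}} :=
  [set S in InfR X | union_of_Inn_orbits X S].

Definition Parabolic (X : {set gT}) : {set {set gT}} :=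
  [set P in InfR X | [forall S in Spherical X, P :&: S != set0]].

End Racks.

(* A complex on a finite vertex type V is given by its predicate of faces. *)

Definition order_complex (T : finType) (P : {set {set T}}) : pred {set {set T}} :=
  fun sigma => (sigma \subset P) &&
    [forall A in sigma, forall B in sigma, (A \subset B) || (B \subset A)].

(* boundary of the (n-1)-simplex on vertices 'I_n: a model of S^(n-2)
   (empty complex, i.e. S^-1, for n = 1) *)
Definition sphere_complex (n : nat) : pred {set 'I_n} :=
  fun A => A != setT.

Definition simplicial_join (V W : finType) (K : pred {set V}) (L : pred {set W})
  : pred {set (V + W)%type} :=
  fun s => K [set v | inl v \in s] && L [set w | inr w \in s].

From mathcomp Require Import all_classical all_reals all_analysis.
Import numFieldNormedType.Exports.
Local Open Scope ring_scope.
Local Open Scope classical_set_scope.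

(* geometric realization inside R^|V| (barycentric coordinates) *)
Definition realization (R : realType) (V : finType) (K : pred {set V})
  : set 'rV[R]_#|V| :=
  [set x : 'rV[R]_#|V| | (forall i, 0 <= x ord0 i) /\ (\sum_i x ord0 i = 1) /\
           K (finset.finset (fun v : V => x ord0 (enum_rank v) != 0))].

Definition homotopy_equivalent (R : realType) (X Y : topologicalType)
    (A : set X) (B : set Y) : Prop :=
  exists (f : X -> Y) (g : Y -> X) (H : R * X -> X) (K : R * Y -> Y),
    [/\ (forall a, A a -> B (f a)), (forall b, B b -> A (g b)),
        {within A, continuous f} & {within B, continuous g}] /\
    [/\ {within `[0, 1] `*` A, continuous H},
        (forall t a, `[0, 1] t -> A a -> A (H (t, a))),
        (forall a, A a -> H (0, a) = g (f a)) &
        (forall a, A a -> H (1, a) = a)] /\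
    [/\ {within `[0, 1] `*` B, continuous K},
        (forall t b, `[0, 1] t -> B b -> B (K (t, b))),
        (forall b, B b -> K (0, b) = f (g b)) &
        (forall b, B b -> K (1, b) = b)].

Arguments realization R {V} K _.
Arguments homotopy_equivalent R {X Y} A B.

Definition realizations_homotopy_equivalent (R : realType) (V W : finType)
    (K : pred {set V}) (L : pred {set W}) : Prop :=
  @homotopy_equivalent R ('rV[R]_#|V| : topologicalType) ('rV[R]_#|W| : topologicalType) (realization R K) (realization R L).
Arguments realizations_homotopy_equivalent R {V W} K L.
Arguments sphere_complex : clear implicits.

(* Main.v *)
(* Call a proper nonempty subrack full if it meets every conjugacy class of <X>
   in X, and write O(A) for the set of classes met by A.  A point of the order
   complex of all proper nonempty subracks is mapped linearly to the join: a
   non-full A goes to the barycentre of O(A), a full A to the intersection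
   [cl A] of the maximal subracks above it, which is parabolic.  In the other
   direction, a point (y, z) of the join determines two increasing step curves
   in a time parameter, both starting at time 0: the superlevel sets s of y,
   and the chain of parabolics Q, each lasting for its weight z_Q, then X.
   Since a full Q meets every class, s :&: Q is a nonempty subrack with
   O(s :&: Q) = s; weighting it by the length of time during which both s and Q
   are current, and normalising, gives a continuous map with values in chains.
   One composite is homotopic to the identity along straight lines.  For the
   other, a point x of the order complex is itself a step curve lying below the
   curve of its image, and the homotopy follows the former up to time t and the
   latter afterwards. *)

Require Import Defs.
From HB Require Import structures.
From mathcomp Require Import all_boot all_order all_algebra all_fingroup all_solvable.
From mathcomp Require Import lra.

Set Implicit Arguments.
Unset Strict Implicit.
Unset Printing Implicit Defensive.

(** * Barycentric coordinates and chains in order complexes *)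

Section Barycentric.
Import Order.TTheory GRing.Theory Num.Theory.
Local Open Scope ring_scope.
Variable R : realFieldType.

Lemma ler_sum_support (I : finType) (P Q : pred I) (F : I -> R) :
    (forall i, 0 <= F i) -> (forall i, P i -> F i != 0 -> Q i) ->
  \sum_(i | P i) F i <= \sum_(i | Q i) F i.
Proof.
move=> F0 PQ; rewrite big_mkcond [leRHS]big_mkcond; apply: ler_sum => i _.
case: ifP => [Pi|_]; last by case: ifP.
by case: (eqVneq (F i) 0) => [->|/(PQ _ Pi) ->] //; case: ifP.
Qed.

(** Points of the realization as functions on the vertices, free of row vectors and topology;
    [realizationP] makes the link. *)
Definition barycentric (V : finType) (K : pred {set V}) (x : V -> R) : Prop :=
  [/\ forall v, 0 <= x v, \sum_v x v = 1 & K [set v | x v != 0]].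

Lemma order_complexP (T : finType) (P : {set {set T}}) (s : {set {set T}}) :
  reflect ({in s, forall A, A \in P} /\
           {in s &, forall A B : {set T}, A \subset B \/ B \subset A})
          (order_complex P s).
Proof.
rewrite /order_complex; apply: (iffP andP) => [[/subsetP sP /forallP ch]|[sP ch]].
  split=> // A B As Bs; have /forallP/(_ B) := implyP (ch A) As.
  by move/implyP/(_ Bs)/orP.
split; first exact/subsetP.
apply/forallP=> A; apply/implyP=> As; apply/forallP=> B; apply/implyP=> Bs.
exact/orP/ch.
Qed.

Lemma order_complex_barycentricP (T : finType) (P : {set {set T}})
    (x : {set T} -> R) :
  barycentric (order_complex P) x <->
  [/\ forall A, 0 <= x A, \sum_A x A = 1, forall A, x A != 0 -> A \in P &
      forall A B, x A != 0 -> x B != 0 -> A \subset B \/ B \subset A].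
Proof.
split=> [[x0 x1 /order_complexP[xP xch]]|[x0 x1 xP xch]].
  by split=> // [A|A B] ? *; [apply: xP|apply: xch]; rewrite inE.
split=> //; apply/order_complexP; split=> [A|A B]; rewrite !inE; [exact: xP|exact: xch].
Qed.

Lemma minimal_support (T : finType) (x : {set T} -> R) A0 :
    (forall A B, x A != 0 -> x B != 0 -> A \subset B \/ B \subset A) ->
    x A0 != 0 ->
  exists2 A, x A != 0 & forall B, x B != 0 -> A \subset B.
Proof.
move=> xch xA0; case: (@arg_minnP _ A0 (fun A => x A != 0) (fun A => #|A|) xA0) => A xA minA.
exists A => // B xB; case: (xch _ _ xA xB) => // sBA.
by rewrite (_ : B = A) //; apply/eqP; rewrite eqEcard sBA minA.
Qed.

Lemma maximal_support (T : finType) (P : pred {set T}) (x : {set T} -> R) A0 :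
    (forall A B, x A != 0 -> x B != 0 -> A \subset B \/ B \subset A) ->
    P A0 -> x A0 != 0 ->
  exists A, [/\ P A, x A != 0 & forall B, P B -> x B != 0 -> B \subset A].
Proof.
move=> xch PA0 xA0; have Q0 : P A0 && (x A0 != 0) by rewrite PA0.
case: (@arg_maxnP _ A0 (fun A => P A && (x A != 0)) (fun A => #|A|) Q0) => A /andP[PA xA] maxA.
exists A; split=> // B PB xB; case: (xch _ _ xA xB) => // sAB.
rewrite (_ : A = B) //; apply/eqP; rewrite eqEcard sAB.
by apply: maxA; rewrite PB.
Qed.

End Barycentric.

(** * Step curves attached to points of the join and of the order complex *)

Section Staircase.
Import Order.TTheory GRing.Theory Num.Theory.
Local Open Scope ring_scope.
Variables (R : realFieldType) (T : finType) (c : nat) (i0 : 'I_c).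
Variables (o : T -> 'I_c) (X : {set T}) (L U : {set {set T}}).
Variable cl : {set T} -> {set T}.

Definition shadow (A : {set T}) : {set 'I_c} := o @: A.
Definition slice (s : {set 'I_c}) (A : {set T}) : {set T} :=
  [set x in A | o x \in s].
Definition full (A : {set T}) : bool := shadow A == setT.

(** All that the homotopy needs from racks: [o] gives the class of an element, [L] the proper
    nonempty subracks, [U] the parabolics, [cl] the closure by maximal subracks. *)
Record join_data : Prop := JoinData {
  _ : forall A, A \in L -> A \proper X;
  _ : forall A, A \in L -> A != set0;
  _ : forall (s : {set 'I_c}) (Q : {set T}), s != set0 -> Q \in X |: U ->
        (s, Q) != (setT, X) -> slice s Q \in L;
  _ : forall Q : {set T}, Q \in X |: U -> full Q;
  _ : {subset U <= L};
  _ : forall A, A \in L -> full A -> cl A \in U;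
  _ : forall A, A \in L -> full A -> A \subset cl A;
  _ : forall A B, A \in L -> full A -> B \in L -> full B ->
        A \subset B -> cl A \subset cl B;
  _ : forall Q, Q \in U -> cl Q = Q }.

Hypothesis D : join_data.

Let L_proper A : A \in L -> A \proper X. Proof. by case: D A. Qed.
Let L_neq0 A : A \in L -> A != set0. Proof. by case: D => _ + *; apply. Qed.
Let slice_L (s : {set 'I_c}) (Q : {set T}) : s != set0 -> Q \in X |: U ->
  (s, Q) != (setT, X) -> slice s Q \in L.
Proof. by case: D s Q. Qed.
Let full_U (Q : {set T}) : Q \in X |: U -> full Q. Proof. by case: D Q. Qed.
Let U_L : {subset U <= L}. Proof. by case: D. Qed.
Let cl_U A : A \in L -> full A -> cl A \in U. Proof. by case: D A. Qed.
Let cl_sub A : A \in L -> full A -> A \subset cl A. Proof. by case: D A. Qed.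
Let cl_mono A B : A \in L -> full A -> B \in L -> full B ->
  A \subset B -> cl A \subset cl B.
Proof. by case: D A B. Qed.
Let cl_id Q : Q \in U -> cl Q = Q. Proof. by case: D Q. Qed.

Local Notation V := ('I_c + {set T})%type.
Local Notation join := (simplicial_join (sphere_complex c) (order_complex U)).

Definition to_join (x : {set T} -> R) (v : V) : R :=
  match v with
  | inl i => \sum_(A in L | ~~ full A && (i \in shadow A)) x A / #|shadow A|%:R
  | inr Q => \sum_(A in L | full A && (cl A == Q)) x A
  end.

Definition height (b : V -> R) : R := \big[Num.max/0]_i b (inl i).
(** The superlevel set at time t is cut at level [height b] minus t, so the classes of largest
    coordinate are present from time 0. *)
Definition entry_time (b : V -> R) (i : 'I_c) : R := height b - b (inl i).
(* [s] is current on the time interval [lo_s, up_s], nonempty only when [s]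
   is a superlevel set of the simplex coordinates; [Q] is current on
   [lo_Q, up_Q], and the top element [X] from the total weight of the
   parabolics up to 1.  The pair [(setT, X)] is never used. *)
Definition lo_s (b : V -> R) (s : {set 'I_c}) : R :=
  \big[Num.max/0]_(i in s) entry_time b i.
Definition up_s (b : V -> R) (s : {set 'I_c}) : R :=
  \big[Num.min/1]_(i in ~: s) entry_time b i.
Definition lo_Q (b : V -> R) (Q : {set T}) : R :=
  \sum_(Q' in U | Q' \proper Q) b (inr Q').
Definition up_Q (b : V -> R) (Q : {set T}) : R :=
  if Q == X then 1 else \sum_(Q' in U | Q' \subset Q) b (inr Q').
(** Length of the part after [t] of the interval on which both components of [d] are current; the
    outer maximum makes it 0 when that part is empty. *)
Definition overlap (t : R) (b : V -> R) (d : {set 'I_c} * {set T}) : R :=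
  Num.max 0 (Num.min (up_s b d.1) (up_Q b d.2)
             - Num.max t (Num.max (lo_s b d.1) (lo_Q b d.2))).
(** An empty [d.1] would give the slice [set0], and [(setT, X)] the slice [X]; neither is a proper
    nonempty subrack. *)
Definition admissible (d : {set 'I_c} * {set T}) : bool :=
  [&& d.1 != set0, d.2 \in X |: U & d != (setT, X)].
(** Several pairs may have the same slice, hence the sum. The time spent at [(setT, X)] is lost, so
    the total over all [A] can be less than 1. *)
Definition stair (t : R) (b : V -> R) (A : {set T}) : R :=
  \sum_(d | admissible d && (slice d.1 d.2 == A)) overlap t b d.

(* Rescaling by [mult] makes the weight that [to_join x] gives to a class equal
   to the time that [x] spends in non-full sets meeting it; this keeps the curve
   of [x] below the curve of [to_join x]. *)
Definition mult (A : {set T}) : R := if full A then 1 else #|shadow A|%:R.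
Definition seg (x : {set T} -> R) (A : {set T}) : R := x A / mult A.
Definition lo_A (x : {set T} -> R) (A : {set T}) : R :=
  \sum_(B in L | B \proper A) seg x B.
(** The part before time [t] of the stay of [x] in [A], converted from a duration back to a weight
    by [mult]. *)
Definition initial (t : R) (x : {set T} -> R) (A : {set T}) : R :=
  if A \in L then
    mult A * Num.max 0 (Num.min (lo_A x A + seg x A) t - lo_A x A)
  else 0.
Definition deform (t : R) (x : {set T} -> R) (A : {set T}) : R :=
  initial t x A + stair t (to_join x) A.

Lemma shadow_slice s A : full A -> shadow (slice s A) = s.
Proof.
move/eqP=> fA; apply/setP=> i; apply/imsetP/idP=> [[a]|is_].
  by rewrite inE => /andP[_ ?] ->.
have: i \in shadow A by rewrite fA inE.
by case/imsetP=> a aA ia; exists a; rewrite // inE aA -ia.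
Qed.

Lemma slice_setT A : slice setT A = A.
Proof. by apply/setP=> a; rewrite !inE andbT. Qed.

Lemma shadowS (A B : {set T}) : A \subset B -> shadow A \subset shadow B.
Proof. exact: imsetS. Qed.

Lemma fullS (A B : {set T}) : A \subset B -> full A -> full B.
Proof. by move=> /shadowS sAB /eqP fA; rewrite /full -subTset -fA. Qed.

Lemma mult_gt0 A : A \in L -> 0 < mult A.
Proof.
move=> AL; rewrite /mult; case: ifP => // _; rewrite ltr0n card_gt0.
by rewrite imset_eq0 L_neq0.
Qed.

Lemma U_proper Q : Q \in U -> Q \proper X. Proof. by move/U_L/L_proper. Qed.

Lemma XU_sub (Q : {set T}) : Q \in X |: U -> Q \subset X.
Proof. by rewrite !inE => /orP[/eqP->//|/U_proper/proper_sub]. Qed.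

(** * The curve of a point of the join *)

Section Stair.
Variables (b : V -> R) (bj : barycentric join b).

Lemma join_ge0 v : 0 <= b v. Proof. by case: bj. Qed.

Lemma join_sum : \sum_i b (inl i) + \sum_Q b (inr Q) = 1.
Proof. by case: bj => _ <- _; rewrite big_sumType. Qed.

Lemma join_missing : exists i, b (inl i) = 0.
Proof.
case: bj => _ _ /andP[+ _]; rewrite /sphere_complex => nT.
have /subsetPn[i _] : ~~ ([set: 'I_c] \subset
    [set v | inl v \in [set v0 | b v0 != 0]]) by rewrite subTset.
by rewrite !inE negbK => /eqP; exists i.
Qed.

Lemma join_supp_U Q : b (inr Q) != 0 -> Q \in U.
Proof.
case: bj => _ _ /andP[_ /order_complexP[sU _]] bQ; apply: sU.
by rewrite !inE.
Qed.

Lemma join_supp_chain Q Q' : b (inr Q) != 0 -> b (inr Q') != 0 ->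
  Q \subset Q' \/ Q' \subset Q.
Proof.
case: bj => _ _ /andP[_ /order_complexP[_ ch]] bQ bQ'; apply: ch;
  by rewrite !inE.
Qed.

Lemma height_ge i : b (inl i) <= height b.
Proof. exact: le_bigmax. Qed.

Lemma height_attained : exists i, b (inl i) = height b.
Proof.
rewrite /height (@bigmax_eq_arg _ _ _ _ i0) //; first by eexists.
by move=> i _; exact: join_ge0.
Qed.

Lemma up_s_le1 s : up_s b s <= 1. Proof. exact: bigmin_le_id. Qed.

Lemma overlap_ge0 t d : 0 <= overlap t b d.
Proof. by rewrite /overlap le_max lexx. Qed.

Lemma overlap_neq0 t d : overlap t b d != 0 ->
  [/\ t < up_s b d.1, t < up_Q b d.2, lo_s b d.1 < up_s b d.1,
      lo_s b d.1 < up_Q b d.2 & lo_Q b d.2 < up_s b d.1 /\ lo_Q b d.2 < up_Q b d.2].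
Proof.
move=> nz; have := overlap_ge0 t d; rewrite le_eqVlt eq_sym (negPf nz) /=.
rewrite /overlap lt_max ltxx /= subr_gt0 lt_min !gt_max.
by case/andP=> /and3P[? ? ?] /and3P[].
Qed.

Lemma lo_s_ge (s : {set 'I_c}) i : i \in s -> entry_time b i <= lo_s b s.
Proof. by move=> ?; apply: le_bigmax_cond. Qed.

Lemma up_s_le (s : {set 'I_c}) i : i \notin s -> up_s b s <= entry_time b i.
Proof. by move=> ?; apply: bigmin_le_cond; rewrite inE. Qed.

(** For [i] in [s] only and [j] in [s'] only, the entry times would satisfy e_i <= lo_s < up_s <=
    e_j <= lo_s' < up_s' <= e_i. *)
Lemma active_chain_s (s s' : {set 'I_c}) : lo_s b s < up_s b s -> lo_s b s' < up_s b s' ->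
  s \subset s' \/ s' \subset s.
Proof.
move=> ls ls'; case: (boolP (s \subset s')) => [|/subsetPn[i is_ is']]; [by left|].
right; apply/subsetP=> j js'; apply: contraT => js.
have := lo_s_ge is_; have := up_s_le is'.
have := lo_s_ge js'; have := up_s_le js.
lra.
Qed.

(** For [Q] in [U] the bounds [lo_Q] and [up_Q] differ by the weight of [Q], so weight 0 means an
    empty interval. *)
Lemma active_supp Q : Q \in U -> lo_Q b Q < up_Q b Q -> b (inr Q) != 0.
Proof.
move=> QU; rewrite /up_Q; case: eqP => [QX|_].
  by have := U_proper QU; rewrite QX properxx.
apply: contraTneq => bQ; rewrite -leNgt; apply: ler_sum_support => [Q'|Q'].
  exact: join_ge0.
case/andP=> Q'U sQ nz; rewrite Q'U properEneq sQ !andbT.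
by apply: contraNneq nz => ->; apply/eqP.
Qed.

Lemma active_chain_Q (Q Q' : {set T}) : Q \in X |: U -> Q' \in X |: U ->
    lo_Q b Q < up_Q b Q -> lo_Q b Q' < up_Q b Q' ->
  Q \subset Q' \/ Q' \subset Q.
Proof.
move=> QX QX' lQ lQ'.
case: (eqVneq Q X) QX => [-> _|nQ]; first by right; exact: XU_sub.
case: (eqVneq Q' X) QX' => [-> _ QX|nQ'].
  by left; exact: XU_sub.
rewrite !inE (negPf nQ) (negPf nQ') /= => Q'U QU.
by apply: join_supp_chain; exact: active_supp.
Qed.

Lemma proper_lo_up_Q (Q Q' : {set T}) : Q \in X |: U -> Q' \proper Q -> up_Q b Q' <= lo_Q b Q.
Proof.
move=> QU pQ; rewrite /up_Q; case: eqP => [Q'X|_].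
  by have := proper_sub_trans pQ (XU_sub QU); rewrite Q'X properxx.
apply: ler_sum_support => [*|Q'' /andP[-> sQ] _]; first exact: join_ge0.
exact: sub_proper_trans pQ.
Qed.

Lemma stair_ge0 t A : 0 <= stair t b A.
Proof. by apply: sumr_ge0 => *; exact: overlap_ge0. Qed.

Lemma stair_neq0 t A : stair t b A != 0 ->
  exists d, [/\ admissible d, slice d.1 d.2 = A & overlap t b d != 0].
Proof.
move/eqP/psumr_neq0P => [d _|d /andP[/andP[ad /eqP sl] nz]].
  exact: overlap_ge0.
by exists d; rewrite gt_eqF.
Qed.

Lemma stair_L t A : stair t b A != 0 -> A \in L.
Proof.
by case/stair_neq0=> -[s Q] [/and3P[s0 QX dX] <- _]; exact: slice_L.
Qed.

Lemma sliceS (s s' : {set 'I_c}) (A A' : {set T}) : s \subset s' -> A \subset A' ->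
  slice s A \subset slice s' A'.
Proof.
move=> ss sA; apply/subsetP=> a; rewrite !inE => /andP[aA as_].
by rewrite (subsetP sA) // (subsetP ss).
Qed.

(** Both components increase with time, so two pairs that are each current at some moment are
    comparable in the same direction. *)
Lemma stair_chain t A B : stair t b A != 0 -> stair t b B != 0 ->
  A \subset B \/ B \subset A.
Proof.
case/stair_neq0=> -[s Q] /= [/and3P[_ /= QX _] <- /overlap_neq0 /= [_ _ l1 l2 [l3 l4]]].
case/stair_neq0=> -[s' Q'] /= [/and3P[_ /= QX' _] <- /overlap_neq0 /= [_ _ l1' l2' [l3' l4']]].
wlog ss : s s' Q Q' QX l1 l2 l3 l4 QX' l1' l2' l3' l4' / s \subset s'.
  move=> wl; case: (active_chain_s l1 l1') => ss; first exact: wl.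
  by rewrite or_comm; apply: wl.
case: (active_chain_Q QX QX' l4 l4') => sQ; first by left; exact: sliceS.
case: (eqVneq s s') => [->|ns]; first by right; exact: sliceS.
case: (eqVneq Q' Q) => [->|nQ]; first by left; exact: sliceS.
(* In the crossed case, up_s s <= e_i <= lo_s s' < up_Q Q' <= lo_Q Q < up_s s, which is absurd. *)
have /properP[_ [i is' is_]] : s \proper s' by rewrite properEneq ns.
have pQ : Q' \proper Q by rewrite properEneq nQ.
have := lo_s_ge is'; have := up_s_le is_; have := proper_lo_up_Q QX pQ.
lra.
Qed.

(** The pair current at time 0 lasts for a positive time: [s] is the set of classes of largest
    coordinate, [Q] the smallest parabolic of the support, or [X] if there is none. *)
Lemma stair_pos : 0 < \sum_A stair 0 b A.
Proof.
pose s := [set i | b (inl i) == height b].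
have [i hi] := height_attained.
have s0 : s != set0 by apply/set0Pn; exists i; rewrite inE hi.
have los : lo_s b s = 0.
  apply/eqP; rewrite eq_le bigmax_ge_id andbT; apply: bigmax_le => // j.
  by rewrite inE /entry_time => /eqP->; rewrite subrr.
have ups : 0 < up_s b s.
  apply: lt_bigmin => // j; rewrite !inE /entry_time subr_gt0 => nj.
  by rewrite lt_neqAle nj height_ge.
have [Q QX [loQ upQ QXz]] : exists2 Q, Q \in X |: U &
    [/\ lo_Q b Q = 0, 0 < up_Q b Q & Q = X -> forall Q', b (inr Q') = 0].
  case: (pickP (fun Q => b (inr Q) != 0)) => [Q0 nz|z].
    have [Q nzQ minQ] := minimal_support (x := b \o inr) join_supp_chain nz.
    have QU := join_supp_U nzQ; exists Q; first by rewrite inE QU orbT.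
    have Qp := U_proper QU; split.
    - apply: big1 => Q' /andP[_ pQ]; apply/eqP; apply: contraTT pQ => /minQ.
      by rewrite properE => ->; rewrite andbF.
    - rewrite /up_Q; case: eqP => // _; rewrite (bigD1 Q) ?QU ?subxx //=.
      apply: ltr_wpDr; first by apply: sumr_ge0 => *; exact: join_ge0.
      by rewrite lt_neqAle eq_sym nzQ join_ge0.
    - by move=> eQ; move: Qp; rewrite eQ properxx.
  have z' Q : b (inr Q) = 0 by apply/eqP; apply: negbFE; exact: z.
  exists X; first by rewrite !inE eqxx.
  by split=> //; [rewrite /lo_Q big1 // | rewrite /up_Q eqxx].
(* Otherwise every simplex coordinate equals the one that vanishes and no parabolic carries weight,
   so the total could not be 1. *)
have dX : (s, Q) != (setT, X).
  apply/eqP=> -[sT /QXz z]; have [j bj0] := join_missing.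
  have h0 : height b = 0.
    have: j \in s by rewrite sT inE.
    by rewrite inE bj0 => /eqP.
  have := join_sum; rewrite !big1 //; first by lra.
  move=> k _; have: k \in s by rewrite sT inE.
  by rewrite inE h0 => /eqP.
have ad : admissible (s, Q) by rewrite /admissible s0 QX dX.
rewrite (bigD1 (slice s Q)) //= ltr_wpDr //.
  by apply: sumr_ge0 => *; exact: stair_ge0.
rewrite /stair (bigD1 (s, Q)) ?ad ?eqxx //= ltr_wpDr //.
  by apply: sumr_ge0 => *; exact: overlap_ge0.
by rewrite /overlap /= los loQ lt_max subr_gt0 !maxxx lt_min ups upQ orbT.
Qed.

Lemma stair1 A : stair 1 b A = 0.
Proof.
apply/eqP; case: eqP => // /eqP/stair_neq0[d [_ _ /overlap_neq0[]]].
by move=> /lt_le_trans/(_ (up_s_le1 _)); rewrite ltxx.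
Qed.

(** Keeps the segment from the image of [b] back to [b] inside one face. A class [i] in a non-full
    slice enters before some [j] outside it, so its coordinate exceeds that of [j] and is positive;
    a full slice is a current parabolic, fixed by [cl]. *)
Lemma to_join_stair_support w v :
    (forall A, 0 <= w A) -> (forall A, w A != 0 -> stair 0 b A != 0) ->
  to_join w v != 0 -> b v != 0.
Proof.
move=> w0 ws; case: v => [i|Q] /= /eqP/psumr_neq0P => [[A _|A]|[A _|A]].
- by rewrite divr_ge0.
- case/andP=> /and3P[AL nfA iA] Apos.
  have /ws/stair_neq0 : w A != 0.
    by apply: contraTneq Apos => ->; rewrite mul0r ltxx.
  move=> [[s Q] /= [/and3P[_ /= QX _] eA /overlap_neq0[_ _ /= ls _ _]]].
  have sA : shadow A = s by rewrite -eA shadow_slice // full_U.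
  move: iA nfA; rewrite /full sA -subTset => is_ /subsetPn[j _ js].
  have := lo_s_ge is_; have := up_s_le js; have := join_ge0 (inl j).
  by rewrite /entry_time => *; rewrite gt_eqF //; lra.
- by [].
- case/andP=> /and3P[AL fA /eqP clA] Apos.
  have /ws/stair_neq0 : w A != 0 by rewrite gt_eqF.
  move=> [[s Q'] /= [/and3P[_ /= QX dX] eA /overlap_neq0[_ _ /= _ _ [_ lQ]]]].
  have sA : shadow A = s by rewrite -eA shadow_slice // full_U.
  have sT : s = setT by rewrite -sA; apply/eqP.
  have AQ' : A = Q' by rewrite -eA sT slice_setT.
  move: dX QX; rewrite sT xpair_eqE eqxx /= => nX; rewrite !inE (negPf nX) /= => Q'U.
  have -> : Q = Q' by rewrite -clA AQ' cl_id.
  exact: active_supp.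
Qed.

End Stair.

(** * Deforming a point of the order complex along its two curves *)

Section Deform.
Variables (x : {set T} -> R) (xp : barycentric (order_complex L) x).

Let xP := (order_complex_barycentricP L x).1 xp.

Lemma pt_ge0 A : 0 <= x A. Proof. by case: xP. Qed.

Lemma pt_L A : x A != 0 -> A \in L. Proof. by case: xP => _ _ + _; apply. Qed.

Lemma pt_chain A B : x A != 0 -> x B != 0 -> A \subset B \/ B \subset A.
Proof. by case: xP => _ _ _; apply. Qed.

Lemma pt_sum : \sum_(A in L) x A = 1.
Proof.
case: xP => _ <- _ _; rewrite [RHS](bigID (mem L)) /= [X in _ + X]big1 ?addr0 //.
by move=> A nL; apply/eqP; apply: contraNT nL; exact: pt_L.
Qed.

Lemma seg_ge0 A : 0 <= seg x A.
Proof. by rewrite divr_ge0 ?pt_ge0 // /mult; case: ifP. Qed.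

Lemma seg_neq0 A : seg x A != 0 -> x A != 0.
Proof. by apply: contraNneq => xA; rewrite /seg xA mul0r. Qed.

Lemma mult_ge1 A : A \in L -> 1 <= mult A.
Proof.
move=> AL; have := mult_gt0 AL; rewrite /mult; case: ifP => // _.
by rewrite ltr0n ler1n.
Qed.

Lemma seg_le A : A \in L -> seg x A <= x A.
Proof.
by move=> AL; rewrite /seg ler_pdivrMr ?mult_gt0 // ler_peMr ?pt_ge0 // mult_ge1.
Qed.

Lemma lo_A_ge0 A : 0 <= lo_A x A.
Proof. by apply: sumr_ge0 => *; exact: seg_ge0. Qed.

(** Durations are at most the weights, whose total is 1. Hence the curve of [x] is over by time 1,
    and [deform] returns [x] there. *)
Lemma up_A_le1 A : A \in L -> lo_A x A + seg x A <= 1.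
Proof.
move=> AL; rewrite -pt_sum (bigD1 A) //= [leLHS]addrC; apply: lerD.
  exact: seg_le.
apply: (le_trans (y := \sum_(B in L | B \proper A) x B)).
  by apply: ler_sum => B /andP[BL _]; exact: seg_le.
apply: ler_sum_support => [*|B /andP[BL pB] _]; first exact: pt_ge0.
by rewrite BL /=; apply: contraTneq pB => ->; rewrite properxx.
Qed.

Lemma to_join_ge0 v : 0 <= to_join x v.
Proof.
by case: v => [i|Q] /=; apply: sumr_ge0 => *; rewrite ?divr_ge0 // pt_ge0.
Qed.

Lemma to_join_sum : \sum_v to_join x v = 1.
Proof.
rewrite big_sumType -[RHS]pt_sum [RHS](bigID full) /= addrC; congr (_ + _).
- rewrite [RHS](partition_big cl xpredT) //=; apply: eq_bigr => Q _.
  by apply: eq_bigl => A; rewrite andbA.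
- rewrite (exchange_big_dep (fun A => (A \in L) && ~~ full A)) /=; last first.
    by move=> i A _ /and3P[-> ->].
  apply: eq_bigr => A /andP[AL nf].
  rewrite (eq_bigl (mem (shadow A))) => [|i /=]; last by rewrite AL nf.
  rewrite sumr_const -[LHS]mulr_natr divfK // pnatr_eq0 -lt0n card_gt0.
  by rewrite imset_eq0 L_neq0.
Qed.

Lemma to_join_barycentric : barycentric join (to_join x).
Proof.
split; [exact: to_join_ge0|exact: to_join_sum|apply/andP; split].
- rewrite /sphere_complex -subTset; apply/subsetPn.
  (* A class missed by the largest non-full set of the support is missed by all non-full ones;
     without such sets any index, here [i0], will do. *)
  have [i ni] : exists i, forall A, A \in L -> ~~ full A -> x A != 0 -> i \notin shadow A.
    case: (pickP (fun A => ~~ full A && (x A != 0))) => [A0 /andP[nf nz]|z].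
      have [A [nfA nzA maxA]] := maximal_support (P := fun A => ~~ full A) pt_chain nf nz.
      move: (nfA); rewrite {1}/full -subTset => /subsetPn[i _ niA]; exists i => B _ nB xB.
      by apply: contra niA; apply/subsetP/shadowS/maxA.
    by exists i0 => A _ nf nz; have := z A; rewrite nf nz.
  exists i => //; rewrite !inE negbK; apply/eqP/big1 => A /and3P[AL nf iA].
  case: (eqVneq (x A) 0) => [->|/(ni _ AL nf)]; first by rewrite mul0r.
  by rewrite iA.
- have supp Q : to_join x (inr Q) != 0 ->
      exists A, [/\ A \in L, full A, cl A = Q & x A != 0].
    move=> /eqP/psumr_neq0P => [[A _|A]]; first exact: pt_ge0.
    by case/andP=> /and3P[AL fA /eqP e] /lt0r_neq0 nz; exists A.
  apply/order_complexP; split=> [Q|Q Q']; rewrite !inE.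
    by case/supp=> A [AL fA <- _]; exact: cl_U.
  move=> /supp[A [AL fA <- xA]] /supp[B [BL fB <- xB]].
  by case: (pt_chain xA xB) => sAB; [left|right]; apply: cl_mono.
Qed.

(** The height is at most the time [x] spends in non-full sets, and the coordinate at [i] is the
    part spent in those meeting [i]. What remains is spent in sets missing [i], which the chain puts
    properly inside [A]. *)
Lemma entry_time_le_lo_A A i : x A != 0 -> i \in shadow A ->
  entry_time (to_join x) i <= lo_A x A.
Proof.
move=> xA iA; rewrite /entry_time lerBlDr.
apply: (le_trans (y := \sum_(B in L | ~~ full B) seg x B)).
  apply: bigmax_le => [|j _].
    by apply: sumr_ge0 => *; exact: seg_ge0.
  rewrite /= (eq_bigr (seg x)) => [|B /and3P[_ nf _]]; last first.
    by rewrite /seg /mult (negPf nf).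
  apply: ler_sum_support => [B|B /and3P[-> -> _]//]; exact: seg_ge0.
rewrite (bigID (fun B => i \in shadow B)) /= addrC; apply: lerD.
  apply: ler_sum_support => [B|B /andP[/andP[BL nf] niB] /seg_neq0 xB].
    exact: seg_ge0.
  rewrite BL /= properE; apply/andP; split.
    case: (pt_chain xA xB) => // sAB.
    by rewrite (subsetP (shadowS sAB)) in niB.
  by apply: contra niB => sAB; rewrite (subsetP (shadowS sAB)).
rewrite le_eqVlt; apply/orP; left; apply/eqP.
apply: eq_big => [B|B /andP[/andP[_ nf] _]]; first by rewrite andbA.
by rewrite /seg /mult (negPf nf).
Qed.

(** The left side adds the durations of the full [B] with [cl B] inside [Q]. Such a [B] cannot
    contain [A], so the chain puts it properly inside [A]. *)
Lemma up_Q_le_lo_A (A Q : {set T}) : x A != 0 -> Q \in X |: U -> ~~ (A \subset Q) ->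
  up_Q (to_join x) Q <= lo_A x A.
Proof.
move=> xA QX nAQ; have sAX := proper_sub (L_proper (pt_L xA)).
rewrite /up_Q; case: eqP => [eQ|_]; first by rewrite eQ sAX in nAQ.
rewrite /= (exchange_big_dep (fun B => (B \in L) && full B)) /=; last first.
  by move=> Q' B _ /and3P[-> ->].
apply: (le_trans (y := \sum_(B | [&& B \in L, full B & cl B \subset Q]) seg x B)).
  rewrite [leRHS](eq_bigl (fun B => [&& B \in L, full B & cl B \subset Q])) //.
  rewrite [leRHS]big_mkcond [leLHS]big_mkcond; apply: ler_sum => B _.
  case: (boolP (B \in L)) => //= BL; case: (boolP (full B)) => //= fB.
  rewrite /seg /mult fB divr1; case: ifP => sB.
    rewrite (eq_bigl (pred1 (cl B))) ?big_pred1_eq // => Q' /=.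
    rewrite eq_sym; case: eqP => [->|]; last by rewrite andbF.
    by rewrite cl_U // sB.
  rewrite big1 // => Q' /andP[/andP[_ sQ] /eqP e].
  by rewrite e sQ in sB.
apply: ler_sum_support => [B|B /and3P[BL fB sB] /seg_neq0 xB]; first exact: seg_ge0.
have nAB : ~~ (A \subset B).
  by apply: contra nAQ => sAB; rewrite (subset_trans sAB) // (subset_trans _ sB) ?cl_sub.
by rewrite BL properE nAB andbT; case: (pt_chain xA xB) nAB => [->|].
Qed.

Lemma initial_ge0 t A : 0 <= initial t x A.
Proof.
rewrite /initial; case: ifP => // AL; apply: mulr_ge0; first exact/ltW/mult_gt0.
by rewrite le_max lexx.
Qed.

Lemma initial_neq0 t A : initial t x A != 0 ->
  [/\ A \in L, x A != 0 & lo_A x A < t].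
Proof.
rewrite /initial; case: ifP => [AL nz|]; last by rewrite eqxx.
have : 0 < Num.max 0 (Num.min (lo_A x A + seg x A) t - lo_A x A).
  rewrite lt_neqAle le_max lexx andbT eq_sym.
  by apply: contraNneq nz => ->; rewrite mulr0.
rewrite lt_max ltxx /= subr_gt0 lt_min => /andP[h ->]; split=> //.
by apply: seg_neq0; apply: contraTneq h => ->; rewrite addr0 ltxx.
Qed.

(** What [x] has reached before [t] lies below what its image shows after [t]: a class of [A]
    outside [s] would give t < up_s <= e_i <= lo_A < t, and similarly for [Q]. *)
Lemma initial_sub_stair t A B : initial t x A != 0 ->
  stair t (to_join x) B != 0 -> A \subset B.
Proof.
move=> /initial_neq0[AL xA lt] /stair_neq0[[s Q]].
move=> /= [/and3P[_ /= QX _] <- /overlap_neq0[/= ts tQ _ _ _]].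
have sA : shadow A \subset s.
  apply/subsetP=> i iA; apply: contraT => is_.
  have := up_s_le (to_join x) is_; have := entry_time_le_lo_A xA iA; lra.
have AQ : A \subset Q.
  by apply: contraT => nAQ; have := up_Q_le_lo_A xA QX nAQ; lra.
apply/subsetP=> a aA; rewrite inE (subsetP AQ) //= (subsetP sA) //.
exact: imset_f.
Qed.

Lemma deform_ge0 t A : 0 <= deform t x A.
Proof. by rewrite addr_ge0 ?initial_ge0 ?stair_ge0. Qed.

Lemma deform_neq0 t A : deform t x A != 0 ->
  initial t x A != 0 \/ stair t (to_join x) A != 0.
Proof.
case: (eqVneq (initial t x A) 0) => [i_0|]; last by left.
by rewrite /deform i_0 add0r; right.
Qed.

Lemma deform_face t : order_complex L [set A | deform t x A != 0].
Proof.
apply/order_complexP; split=> [A|A B]; rewrite !inE.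
  by move/deform_neq0=> [/initial_neq0[]|/stair_L].
move=> /deform_neq0[iA|sA] /deform_neq0[iB|sB].
- have [_ xA _] := initial_neq0 iA; have [_ xB _] := initial_neq0 iB.
  exact: pt_chain.
- by left; exact: initial_sub_stair iA sB.
- by right; exact: initial_sub_stair iB sA.
- by apply: stair_chain sA sB; exact: to_join_barycentric.
Qed.

Lemma initial0 A : initial 0 x A = 0.
Proof.
by apply/eqP; apply: contraT => /initial_neq0[_ _]; rewrite ltNge lo_A_ge0.
Qed.

Lemma deform0 A : deform 0 x A = stair 0 (to_join x) A.
Proof. by rewrite /deform initial0 add0r. Qed.

Lemma deform1 A : deform 1 x A = x A.
Proof.
rewrite /deform stair1 addr0.
rewrite /initial; case: (boolP (A \in L)) => [AL|nA]; last first.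
  by apply/esym/eqP; apply: contraNT nA; exact: pt_L.
have /min_idPl -> := up_A_le1 AL.
have /max_idPr -> : 0 <= lo_A x A + seg x A - lo_A x A.
  by rewrite addrC addKr seg_ge0.
by rewrite [_ - _]addrC addKr mulrC divfK // gt_eqF // mult_gt0.
Qed.

(** For positive [t] the smallest set of the support, current from time 0, already contributes; at 0
    only the staircase is left. *)
Lemma deform_pos t : 0 <= t -> 0 < \sum_A deform t x A.
Proof.
rewrite le_eqVlt => /predU1P[<-|t0].
  rewrite (eq_bigr _ (fun A _ => deform0 A)); apply: stair_pos.
  exact: to_join_barycentric.
have [A0 xA0] : exists A, x A != 0.
  have /psumr_neq0P nz : \sum_(A in L) x A <> 0.
    by rewrite pt_sum; apply/eqP/oner_neq0.
  have [A _|A /andP[_ /lt0r_neq0 xA]] := nz; first exact: pt_ge0.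
  by exists A.
have [A xA minA] := minimal_support pt_chain xA0.
have AL := pt_L xA.
have lo0 : lo_A x A = 0.
  apply: big1 => B /andP[_ pB]; apply/eqP; apply: contraTT pB => /seg_neq0/minA.
  by rewrite properE => ->; rewrite andbF.
rewrite (bigD1 A) //= ltr_wpDr //; first by apply: sumr_ge0 => *; exact: deform_ge0.
rewrite /deform ltr_wpDr ?stair_ge0 //.
rewrite /initial AL mulr_gt0 ?mult_gt0 // lo0 add0r subr0 lt_max lt_min t0.
by rewrite divr_gt0 ?mult_gt0 ?orbT // lt_neqAle eq_sym xA pt_ge0.
Qed.

End Deform.

End Staircase.

(** * Invariance and base point of the rack of p-elements *)

Lemma Gp_norm (gT : finGroupType) (G : {group gT}) p :
  (Gp G p \subset 'N(Gp G p))%g.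
Proof.
apply/subsetP=> a; rewrite inE => /andP[aG _]; rewrite inE.
apply/subsetP=> _ /imsetP[y + ->]; rewrite !inE => /andP[yG py].
by rewrite groupJ // p_eltJ.
Qed.

Lemma Gp1 (gT : finGroupType) (G : {group gT}) p : 1%g \in Gp G p.
Proof. by rewrite inE group1 p_elt1. Qed.

(** * Classes, maximal subracks and parabolics in a self-normalising subset of a group *)

Section Racks.
Local Open Scope group_scope.
Variables (gT : finGroupType) (X : {set gT}) (x0 : gT).
Hypotheses (normX : X \subset 'N(X)) (Xx0 : x0 \in X).

Local Notation N := <<X>>.
Local Notation orbits := [set C in classes N | C \subset X].

Lemma class_sub_rack x : x \in X -> x ^: N \subset X.
Proof.
move=> xX; have nNX : N \subset 'N(X) by rewrite gen_subG.
by apply/subsetP=> _ /imsetP[g /(subsetP nNX) gN ->]; rewrite memJ_norm.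
Qed.

Lemma class_orbits x : x \in X -> x ^: N \in orbits.
Proof. by move=> xX; rewrite inE class_sub_rack // mem_classes // mem_gen. Qed.

(** Total on [gT]: the class of [x0] supplies the default for elements outside [X]. *)
Definition class_index (x : gT) : 'I_#|orbits| :=
  enum_rank_in (class_orbits Xx0) (x ^: N).

Lemma class_index_eq x y : x \in X -> y \in X ->
  (class_index x == class_index y) = (y \in x ^: N).
Proof.
move=> xX yX; rewrite class_sym; apply/eqP/idP.
  move/enum_rank_in_inj => /(_ (class_orbits xX) (class_orbits yX)) <-.
  exact: class_refl.
by move/class_eqP=> e; rewrite /class_index e.
Qed.

Lemma class_index_surj i : exists2 x, x \in X & class_index x = i.
Proof.
have := enum_valP i; rewrite !inE => /andP[/imsetP[x _ e] sX].
exists x; first by rewrite (subsetP sX) // e class_refl.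
by rewrite /class_index -e enum_valK_in.
Qed.

Lemma full_class_indexP (A : {set gT}) : A \subset X ->
  reflect (forall x, x \in X -> exists2 a, a \in A & a \in x ^: N)
          (full class_index A).
Proof.
move=> sAX; apply: (iffP eqP) => [fA x xX|AX].
  have: class_index x \in shadow class_index A by rewrite fA inE.
  case/imsetP=> a aA /eqP; rewrite class_index_eq ?(subsetP sAX a) // => ax.
  by exists a.
apply/setP=> i; rewrite inE; have [x xX <-] := class_index_surj i.
have [a aA ax] := AX x xX; apply/imsetP; exists a => //.
by apply/eqP; rewrite class_index_eq //; apply: (subsetP sAX).
Qed.

Lemma is_subrackP (S : {set gT}) :
  reflect (S \subset X /\ {in S &, forall a b, b ^ a^-1 \in S}) (is_subrack X S).
Proof.
apply: (iffP andP) => -[sSX SS]; split=> //.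
  move=> a b aS bS; have /forallP/(_ b) := implyP (forallP SS a) aS.
  by move/implyP/(_ bS).
by apply/forallP=> a; apply/implyP=> aS; apply/forallP=> b; apply/implyP/SS.
Qed.

Lemma RbarP (S : {set gT}) :
  (S \in Rbar X) = [&& S != X, S != set0 & is_subrack X S].
Proof. by rewrite !inE negb_or andbA. Qed.

Lemma normal_subrack (S : {set gT}) :
  S \subset X -> X \subset 'N(S) -> is_subrack X S.
Proof.
move=> sSX nS; apply/is_subrackP; split=> // a b aS bS.
by rewrite memJ_norm // groupV (subsetP nS) // (subsetP sSX).
Qed.

Lemma is_subrackJ (S : {set gT}) a :
  a \in X -> is_subrack X S -> is_subrack X (S :^ a).
Proof.
move=> aX /is_subrackP[sSX SS]; apply/is_subrackP; split.
  by rewrite -(normP (subsetP normX a aX)) conjSg.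
move=> _ _ /imsetP[u uS ->] /imsetP[v vS ->].
by rewrite -conjVg -conjJg memJ_conjg SS.
Qed.

Lemma max_proper_subrackP (M : {set gT}) :
  reflect [/\ is_subrack X M, M != X &
             forall S, is_subrack X S -> S != X -> M \subset S -> S = M]
          (max_proper_subrack X M).
Proof.
apply: (iffP maxsetP) => [[/andP[rM nM] maxM]|[rM nM maxM]].
  by split=> // S rS nS; apply: maxM; rewrite rS.
by split=> [|S /andP[]]; [rewrite rM|exact: maxM].
Qed.

Lemma max_proper_subrackJ (M : {set gT}) a : a \in X ->
  max_proper_subrack X M -> max_proper_subrack X (M :^ a).
Proof.
move=> aX /max_proper_subrackP[rM nM maxM].
have Xa : X :^ a = X by exact/normP/(subsetP normX).
have Xa' : X :^ a^-1 = X by rewrite -{1}Xa conjsgK.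
apply/max_proper_subrackP; split; first exact: is_subrackJ.
  by apply: contra nM => /eqP e; rewrite -Xa' -e conjsgK.
move=> S rS nS sMS; rewrite -[LHS](conjsgKV a); congr (_ :^ a); apply: maxM.
(* [X] is not assumed closed under inverses, so conjugation by the inverse is an iterate of
   conjugation by [a]. *)
- have -> : S :^ a^-1 = S :^ (a ^+ #[a].-1) by rewrite -invg_expg.
  elim: #[a].-1 => [|k IH]; first by rewrite expg0 conjsg1.
  by rewrite expgSr conjsgM is_subrackJ.
- by apply: contra nS => /eqP e; rewrite -Xa -e conjsgKV.
- by rewrite -sub_conjg.
Qed.

Lemma max_proper_subrack_exists (S : {set gT}) : is_subrack X S -> S != X ->
  exists2 M, max_proper_subrack X M & S \subset M.
Proof.
move=> rS nS; pose P (S : {set gT}) := is_subrack X S && (S != X).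
have PS : P S by rewrite /P rS.
by have [M maxM sSM] := maxset_exists PS; exists M.
Qed.

(** With no maximal subrack above [A] this is the whole type; for [A] in [Rbar X] the family is
    nonempty. *)
Definition rack_closure (A : {set gT}) : {set gT} :=
  \bigcap_(M | max_proper_subrack X M && (A \subset M)) M.

Lemma rack_closure_sub (A : {set gT}) : A \subset rack_closure A.
Proof. by apply/bigcapsP=> M /andP[]. Qed.

Lemma rack_closureS (A B : {set gT}) :
  A \subset B -> rack_closure A \subset rack_closure B.
Proof.
move=> sAB; apply/bigcapsP=> M /andP[maxM sBM]; apply: bigcap_inf.
by rewrite maxM (subset_trans sAB).
Qed.

Lemma rack_closure_InfR (A : {set gT}) : A \in Rbar X -> rack_closure A \in InfR X.
Proof.
rewrite RbarP => /and3P[nAX nA0 rA].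
have [M0 maxM0 sAM0] := max_proper_subrack_exists rA nAX.
have sM0 : rack_closure A \subset M0 by apply: bigcap_inf; rewrite maxM0.
have [/is_subrackP[sM0X _] nM0 _] := max_proper_subrackP _ maxM0.
rewrite inE RbarP; apply/andP; split.
  apply/and3P; split.
  - apply: contra nM0 => /eqP e; rewrite eqEsubset sM0X /=.
    by move: sM0; rewrite e.
  - by apply: contra nA0 => /eqP e; rewrite -subset0 -e rack_closure_sub.
  - apply/is_subrackP; split; first exact: subset_trans sM0 sM0X.
    move=> a b /bigcapP aM /bigcapP bM; apply/bigcapP=> M MP.
    have /andP[/max_proper_subrackP[/is_subrackP[_ MM] _ _] _] := MP.
    by apply: MM; [exact: aM|exact: bM].
apply/existsP; exists [set M : {set gT} | max_proper_subrack X M && (A \subset M)].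
apply/and3P; split.
- by apply/set0Pn; exists M0; rewrite inE maxM0.
- by apply/forallP=> M; apply/implyP; rewrite inE => /andP[].
- by apply/eqP; apply: eq_bigl => M; rewrite inE.
Qed.

(** Each member of a family of maximal subracks with intersection [A] contains [A], so it takes part
    in the closure. *)
Lemma rack_closure_id (A : {set gT}) : A \in InfR X -> rack_closure A = A.
Proof.
rewrite inE => /andP[_ /existsP[F /and3P[_ /forallP maxF /eqP defA]]].
apply/eqP; rewrite eqEsubset rack_closure_sub andbT {2}defA.
apply/bigcapsP=> M MF; apply: bigcap_inf.
by rewrite (implyP (maxF M) MF) defA bigcap_inf.
Qed.

(** Conjugation by an element of [X] permutes the maximal subracks above an invariant set. *)
Lemma rack_closure_norm (A : {set gT}) :
  X \subset 'N(A) -> X \subset 'N(rack_closure A).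
Proof.
move=> nA; apply/subsetP=> a aX; rewrite inE; apply/subsetP=> _ /imsetP[y yA ->].
apply/bigcapP=> M /andP[maxM sAM].
have aN : a \in 'N(A) by exact: subsetP nA a aX.
have Ea : M :^ a^-1 = M :^ (a ^+ #[a].-1) by rewrite -invg_expg.
have maxM' : max_proper_subrack X (M :^ a^-1).
  rewrite Ea; elim: #[a].-1 => [|k IH]; first by rewrite expg0 conjsg1.
  by rewrite expgSr conjsgM max_proper_subrackJ.
move/bigcapP: yA => /(_ (M :^ a^-1)); rewrite mem_conjgV; apply.
by rewrite maxM' -sub_conjg (normP aN).
Qed.

(* [X \ B] is a proper subrack for every class [B], so the invariant set
   [rack_closure C] cannot meet a class other than [C] itself. *)
Lemma class_InfR x : x \in X -> x ^: N != X -> x ^: N \in InfR X.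
Proof.
move=> xX nC; set C := x ^: N.
have sCX : C \subset X := class_sub_rack xX.
have norm_class z : X \subset 'N(z ^: N).
  by apply: subset_trans (subset_gen X) _; exact: class_norm.
have CR : C \in Rbar X.
  rewrite RbarP nC (normal_subrack sCX (norm_class x)) andbT.
  by apply/set0Pn; exists x; exact: class_refl.
suff <- : rack_closure C = C by exact: rack_closure_InfR.
apply/eqP; rewrite eqEsubset rack_closure_sub andbT.
apply/subsetP=> y yC; apply: contraT => nyC.
have := rack_closure_InfR CR; rewrite inE RbarP.
case/andP=> /and3P[_ _ /is_subrackP[sclX _]] _.
have yX : y \in X := subsetP sclX y yC.
pose B := y ^: N.
have rB : is_subrack X (X :\: B).
  by apply: normal_subrack; [exact: subsetDl|exact: normsD normX (norm_class y)].
have nB : X :\: B != X.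
  by apply/eqP=> e; have := yX; rewrite -e inE class_refl.
have [M maxM sBM] := max_proper_subrack_exists rB nB.
have sCM : C \subset M.
  apply: subset_trans sBM; rewrite subsetD sCX -setI_eq0.
  apply/eqP/setP=> z; rewrite !inE; apply: contraNF nyC => /andP[].
  by move=> /class_eqP zx /class_eqP zy; rewrite /C -zx zy class_refl.
have sclM : rack_closure C \subset M by apply: bigcap_inf; rewrite maxM.
have sBcl : B \subset rack_closure C.
  have nN : N \subset 'N(rack_closure C).
    by rewrite gen_subG; exact: rack_closure_norm (norm_class x).
  by apply/subsetP=> _ /imsetP[g /(subsetP nN) gN ->]; rewrite memJ_norm.
have [/is_subrackP[sMX _] /negP nM _] := max_proper_subrackP _ maxM.
case: nM; rewrite eqEsubset sMX /=; apply/subsetP=> z zX.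
case: (boolP (z \in B)) => [/(subsetP sBcl)/(subsetP sclM)//|nz].
by rewrite (subsetP sBM) // inE nz.
Qed.

Lemma union_of_Inn_orbitsP (S : {set gT}) :
  reflect (X \subset 'N(S)) (union_of_Inn_orbits X S).
Proof.
apply: (iffP forallP) => [orbS|nS x].
  (* The generators of [Inn X] conjugate by inverses, so the inverse of [a] is shown to normalise
     [S]. *)
  apply/subsetP=> a aX; rewrite -groupV inE; apply/subsetP=> _ /imsetP[y yS ->].
  have /subsetP := implyP (orbS y) yS; apply.
  apply/orbitP; exists (actperm 'J a^-1).
    by apply: mem_gen; apply/imsetP; exists a.
  by rewrite /= /aperm actpermE.
apply/implyP=> xS; rewrite acts_sub_orbit // gen_subG.
apply/subsetP=> _ /imsetP[a aX ->]; rewrite !inE; apply/subsetP=> y yS.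
rewrite inE /= /aperm actpermE /= memJ_norm // groupV.
exact: subsetP nS a aX.
Qed.

Lemma class_Spherical x : x \in X -> x ^: N != X -> x ^: N \in Spherical X.
Proof.
move=> xX nC; rewrite inE class_InfR //=; apply/union_of_Inn_orbitsP.
by apply: subset_trans (subset_gen X) _; exact: class_norm.
Qed.

(** A class other than [X] is itself spherical, and conversely a spherical set contains the whole
    class of each of its elements. If [X] is a single class, nonemptiness of [P] suffices. *)
Lemma ParabolicP (P : {set gT}) :
  (P \in Parabolic X) = (P \in InfR X) && full class_index P.
Proof.
rewrite inE; case: (boolP (P \in InfR X)) => //= PI.
have := PI; rewrite inE RbarP => /andP[/and3P[_ P0 /is_subrackP[sPX _]] _].
apply/forallP/(full_class_indexP sPX) => [PS x xX|PX S].
  case: (eqVneq (x ^: N) X) => [->|nC].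
    by have [a aP] := set0Pn _ P0; exists a => //; exact: (subsetP sPX).
  have /set0Pn[a] := implyP (PS _) (class_Spherical xX nC).
  by rewrite inE => /andP[]; exists a.
apply/implyP; rewrite inE => /andP[SI /union_of_Inn_orbitsP nS].
move: SI; rewrite inE RbarP => /andP[/and3P[_ /set0Pn[x xS] /is_subrackP[sSX _]] _].
have [a aP /imsetP[g gN ax]] := PX x (subsetP sSX x xS).
apply/set0Pn; exists a; rewrite inE aP ax memJ_norm //.
by apply: subsetP gN; rewrite gen_subG.
Qed.

Lemma slice_subrack (s : {set 'I_#|orbits|}) (Q : {set gT}) :
  is_subrack X Q -> is_subrack X (slice class_index s Q).
Proof.
case/is_subrackP=> sQX QQ; apply/is_subrackP; split=> [|a b].
  by apply/subsetP=> a; rewrite inE => /andP[/(subsetP sQX)].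
rewrite !inE => /andP[aQ _] /andP[bQ bs]; rewrite QQ //=.
rewrite (_ : class_index _ = class_index b) //; rewrite /class_index classGidl //.
by rewrite groupV mem_gen // (subsetP sQX).
Qed.

Lemma rack_join_data :
  join_data class_index X (Rbar X) (Parabolic X) rack_closure.
Proof.
have rX : is_subrack X X by exact: normal_subrack.
have fX : full class_index X.
  by apply/full_class_indexP=> // x xX; exists x; rewrite ?class_refl.
have PX (Q : {set gT}) : Q \in X |: Parabolic X ->
    is_subrack X Q /\ full class_index Q.
  rewrite in_setU1 ParabolicP => /predU1P[->|/andP[]] //.
  by rewrite inE RbarP => /andP[/and3P[]].
split.
- by move=> A; rewrite RbarP properEneq => /and3P[-> _ /is_subrackP[]].
- by move=> A; rewrite RbarP => /and3P[].
- move=> s Q s0 QX nsQ; have [rQ fQ] := PX Q QX.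
  rewrite RbarP slice_subrack // andbT; apply/andP; split.
    (* If the slice is [X], comparing shadows gives [s = setT], and then [Q = X]. *)
    apply: contra nsQ => /eqP e; have := shadow_slice s fQ.
    rewrite e (eqP fX) => sT; rewrite -sT slice_setT in e.
    by rewrite e -sT.
  apply: contra s0 => /eqP e; have := shadow_slice s fQ.
  by rewrite e /shadow imset0 => <-.
- by move=> Q /PX[].
- by move=> Q; rewrite ParabolicP inE => /andP[/andP[]].
- move=> A AR fA; rewrite ParabolicP rack_closure_InfR //=.
  exact: fullS (rack_closure_sub A) fA.
- by move=> A _ _; exact: rack_closure_sub.
- by move=> A B _ _ _ _; exact: rack_closureS.
- by move=> Q; rewrite ParabolicP => /andP[/rack_closure_id].
Qed.

End Racks.

From mathcomp Require Import all_classical all_reals all_analysis.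
Import numFieldNormedType.Exports.

(** * Continuity at a point for real-valued and row-valued maps *)

Section PointwiseContinuity.
Import Order.TTheory GRing.Theory Num.Theory.
Local Open Scope ring_scope.
Local Open Scope classical_set_scope.
Variables (R : realType) (E : topologicalType) (a : E).
Implicit Types f g : E -> R.

Lemma continuous_at_ext f g : f =1 g ->
  {for a, continuous f} -> {for a, continuous g}.
Proof. by move/funext => ->. Qed.

Lemma continuous_at_add f g : {for a, continuous f} -> {for a, continuous g} ->
  {for a, continuous (fun e => f e + g e)}.
Proof. exact: continuousD. Qed.

Lemma continuous_at_sub f g : {for a, continuous f} -> {for a, continuous g} ->
  {for a, continuous (fun e => f e - g e)}.
Proof. exact: continuousB. Qed.

Lemma continuous_at_mul f g : {for a, continuous f} -> {for a, continuous g} ->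
  {for a, continuous (fun e => f e * g e)}.
Proof. exact: continuousM. Qed.

Lemma continuous_at_div f g : g a != 0 ->
    {for a, continuous f} -> {for a, continuous g} ->
  {for a, continuous (fun e => f e / g e)}.
Proof. by move=> ga cf cg; apply: continuous_at_mul => //; exact: continuousV. Qed.

Lemma continuous_at_max f g : {for a, continuous f} -> {for a, continuous g} ->
  {for a, continuous (fun e => Num.max (f e) (g e))}.
Proof. exact: continuous_max. Qed.

Lemma continuous_at_min f g : {for a, continuous f} -> {for a, continuous g} ->
  {for a, continuous (fun e => Num.min (f e) (g e))}.
Proof. exact: continuous_min. Qed.

(** Stated for any operation so as to serve sums, maxima and minima alike. *)
Lemma continuous_at_big (op : R -> R -> R) (z : R) (I : Type) (r : seq I)
    (P : pred I) (F : I -> E -> R) :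
    (forall f g, {for a, continuous f} -> {for a, continuous g} ->
       {for a, continuous (fun e => op (f e) (g e))}) ->
    (forall i, P i -> {for a, continuous (F i)}) ->
  {for a, continuous (fun e => \big[op/z]_(i <- r | P i) F i e)}.
Proof.
move=> cop cF; elim: r => [|i r IH].
  apply: (@continuous_at_ext (fun=> z)) => [e|]; first by rewrite big_nil.
  exact: cst_continuous.
pose G e := \big[op/z]_(j <- r | P j) F j e.
apply: (@continuous_at_ext (fun e => if P i then op (F i e) (G e) else G e)).
  by move=> e; rewrite big_cons.
by case: (boolP (P i)) => // Pi; apply: cop => //; exact: cF.
Qed.

Lemma continuous_at_sum (I : Type) (r : seq I) (P : pred I) (F : I -> E -> R) :
    (forall i, P i -> {for a, continuous (F i)}) ->
  {for a, continuous (fun e => \sum_(i <- r | P i) F i e)}.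
Proof. by apply: continuous_at_big => f g; exact: continuous_at_add. Qed.

Lemma continuous_at_row n (F : E -> 'rV[R]_n) :
    (forall i, {for a, continuous (fun e => F e ord0 i)}) ->
  {for a, continuous F}.
Proof.
move=> cF B [P nP sB]; apply: (@filterS _ (nbhs a) _ (fun e => forall i, P ord0 i (F e ord0 i))).
  by move=> e Pe; apply: sB => i j; rewrite (ord1 i).
apply: filter_forall => i.
exact: cF.
Qed.

End PointwiseContinuity.

(** * Barycentric coordinates on geometric realizations *)

Section Realization.
Import Order.TTheory GRing.Theory Num.Theory.
Local Open Scope ring_scope.
Local Open Scope classical_set_scope.
Variables (R : realType) (V : finType).

Definition coord (x : 'rV[R]_#|V|) (v : V) : R := x ord0 (enum_rank v).

Definition normalize (w : V -> R) : 'rV[R]_#|V| :=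
  \row_i (w (enum_val i) / \sum_v w v).

Lemma coord_normalize w v : coord (normalize w) v = w v / \sum_u w u.
Proof. by rewrite /coord mxE enum_rankK. Qed.

Lemma sum_coord x : \sum_v coord x v = \sum_i x ord0 i.
Proof.
rewrite (reindex (@enum_val V xpredT)) /=; last first.
  by apply: onW_bij; exact: enum_val_bij.
by apply: eq_bigr => i _; rewrite /coord enum_valK.
Qed.

Lemma realizationP (K : pred {set V}) x :
  realization R K x <-> barycentric K (coord x).
Proof.
split=> [[x0 [x1 xK]]|[x0 x1 xK]].
  split; [by move=> v; exact: x0|by rewrite sum_coord|]. exact: xK.
by split=> [i|]; [have := x0 (enum_val i); rewrite /coord enum_valK|rewrite -sum_coord].
Qed.

Lemma normalize_realization (K : pred {set V}) (w : V -> R) :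
    (forall v, 0 <= w v) -> 0 < \sum_v w v ->
    K (finset.finset (fun v => w v != 0)) ->
  realization R K (normalize w).
Proof.
move=> w0 w1 wK; apply/realizationP; split=> [v||].
- by rewrite coord_normalize divr_ge0 // ltW.
- under eq_bigr do rewrite coord_normalize.
  by rewrite -mulr_suml divff // gt_eqF.
- rewrite (_ : finset.finset _ = finset.finset (fun v => w v != 0)) //.
  apply/setP=> v; rewrite !inE coord_normalize mulf_eq0 invr_eq0.
  by rewrite (gt_eqF w1) orbF.
Qed.

Lemma normalize_coord x : \sum_v coord x v = 1 -> normalize (coord x) = x.
Proof.
by move=> x1; apply/rowP=> i; rewrite mxE x1 divr1 /coord enum_valK.
Qed.

Lemma continuous_at_coord (E : topologicalType) (a : E) (F : E -> 'rV[R]_#|V|) v :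
  {for a, continuous F} -> {for a, continuous (fun e => coord (F e) v)}.
Proof.
move=> cF; apply: (@continuous_comp _ _ _ F (fun M : 'rV[R]_#|V| => coord M v)) => //.
exact: coord_continuous.
Qed.

Lemma continuous_at_normalize (E : topologicalType) (a : E) (w : E -> V -> R) :
    (forall v, {for a, continuous (fun e => w e v)}) -> \sum_v w a v != 0 ->
  {for a, continuous (fun e => normalize (w e))}.
Proof.
move=> cw wa; apply: continuous_at_row => i.
apply: (@continuous_at_ext _ _ _ (fun e => w e (enum_val i) / \sum_v w e v)).
  by move=> e; rewrite mxE.
by apply: continuous_at_div => //; exact: continuous_at_sum.
Qed.

End Realization.

(** * The homotopy equivalence between the order complex and the join *)

Section JoinEquivalence.
Import Order.TTheory GRing.Theory Num.Theory.
Local Open Scope ring_scope.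
Local Open Scope classical_set_scope.
Variables (R : realType) (T : finType) (c : nat) (i0 : 'I_c).
Variables (o : T -> 'I_c) (X : {set T}) (L U : {set {set T}}).
Variable cl : {set T} -> {set T}.
Hypothesis D : join_data o X L U cl.

Local Notation V := ('I_c + {set T})%type.
Local Notation join := (simplicial_join (sphere_complex c) (order_complex U)).

Section Continuity.
Variables (E : topologicalType) (a : E).

Lemma continuous_at_to_join (x : E -> {set T} -> R) v :
    (forall A, {for a, continuous (fun e => x e A)}) ->
  {for a, continuous (fun e => to_join o L cl (x e) v)}.
Proof.
move=> cx; case: v => [i|Q] /=; apply: continuous_at_sum => A _ //.
by apply: continuous_at_mul => //; exact: cst_continuous.
Qed.

Lemma continuous_at_stair (t : E -> R) (b : E -> V -> R) A :
    {for a, continuous t} ->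
    (forall v, {for a, continuous (fun e => b e v)}) ->
  {for a, continuous (fun e => stair o X U (t e) (b e) A)}.
Proof.
move=> ct cb; apply: continuous_at_sum => -[s Q] _.
have ce i : {for a, continuous (fun e => entry_time (b e) i)}.
  apply: continuous_at_sub => //; apply: continuous_at_big => // f g.
  exact: continuous_at_max.
apply: continuous_at_max; first exact: cst_continuous.
apply: continuous_at_sub.
  apply: continuous_at_min.
    by apply: continuous_at_big => // f g; exact: continuous_at_min.
  rewrite /up_Q /=; case: (Q == X); first exact: cst_continuous.
  exact: continuous_at_sum.
apply: continuous_at_max => //; apply: continuous_at_max.
  by apply: continuous_at_big => // f g; exact: continuous_at_max.
exact: continuous_at_sum.
Qed.

Lemma continuous_at_deform (t : E -> R) (x : E -> {set T} -> R) A :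
    {for a, continuous t} ->
    (forall B, {for a, continuous (fun e => x e B)}) ->
  {for a, continuous (fun e => deform o X L U cl (t e) (x e) A)}.
Proof.
move=> ct cx; have cs B : {for a, continuous (fun e => seg o (x e) B)}.
  by apply: continuous_at_mul => //; exact: cst_continuous.
have cl' B : {for a, continuous (fun e => lo_A o L (x e) B)}.
  exact: continuous_at_sum.
apply: continuous_at_add.
  rewrite /initial; case: (A \in L); last exact: cst_continuous.
  apply: continuous_at_mul; first exact: cst_continuous.
  apply: continuous_at_max; first exact: cst_continuous.
  apply: continuous_at_sub => //; apply: continuous_at_min => //.
  exact: continuous_at_add.
by apply: continuous_at_stair => // v; exact: continuous_at_to_join.
Qed.

End Continuity.

(** On the realizations the weights in [f] and [K] already sum to 1, so [normalize] only makes row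
    vectors of them; in [g] and [H] it may rescale. *)
Let f (x : 'rV[R]_#|{set T}|) : 'rV[R]_#|{: V}| :=
  normalize (to_join o L cl (coord x)).
Let g (b : 'rV[R]_#|{: V}|) : 'rV[R]_#|{set T}| :=
  normalize (stair o X U 0 (coord b)).
Let H (p : R * 'rV[R]_#|{set T}|) : 'rV[R]_#|{set T}| :=
  normalize (deform o X L U cl p.1 (coord p.2)).
Let K (p : R * 'rV[R]_#|{: V}|) : 'rV[R]_#|{: V}| :=
  normalize (fun v => (1 - p.1) * coord (f (g p.2)) v + p.1 * coord p.2 v).

Let coord_f x : realization R (order_complex L) x ->
  coord (f x) = to_join o L cl (coord x).
Proof.
move=> /realizationP xL; apply/funext => v.
by rewrite coord_normalize (to_join_sum D xL) divr1.
Qed.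

Let f_join x : realization R (order_complex L) x -> realization R join (f x).
Proof.
move=> xL; apply/realizationP; rewrite coord_f //.
by apply: (to_join_barycentric i0 D); exact/realizationP.
Qed.

Let g_L b : realization R join b -> realization R (order_complex L) (g b).
Proof.
move=> /realizationP bj; apply: normalize_realization => [A||].
- exact: stair_ge0.
- exact: (stair_pos i0 D bj).
- apply/order_complexP; split=> [A|A B]; rewrite !inE.
    exact: (stair_L D).
  exact: (stair_chain D bj).
Qed.

Let sum_coord_realization (W : finType) (J : pred {set W}) x :
  realization R J x -> \sum_v coord x v = 1.
Proof. by case/realizationP. Qed.

Let fg_support b v : realization R join b -> coord (f (g b)) v != 0 ->
  coord b v != 0.
Proof.
move=> bj; have gL := g_L bj; have /realizationP[g0 _ _] := gL.
rewrite coord_f //; apply: (to_join_stair_support D).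
- exact/realizationP.
- exact: g0.
- by move=> A; rewrite coord_normalize mulf_eq0 negb_or => /andP[].
Qed.

Let K_sum t b : realization R join b ->
  \sum_v ((1 - t) * coord (f (g b)) v + t * coord b v) = 1.
Proof.
move=> bj; rewrite big_split /= -!mulr_sumr.
rewrite (sum_coord_realization bj) (sum_coord_realization (f_join (g_L bj))).
by rewrite !mulr1 subrK.
Qed.

Let K_join t b : 0 <= t <= 1 -> realization R join b -> realization R join (K (t, b)).
Proof.
move=> /andP[t0 t1] bj.
have /realizationP[b0 b1 bJ] := bj.
have /realizationP[w0 w1 wJ] := f_join (g_L bj).
(* At time 0 the support is that of [f (g b)], possibly smaller than that of [b]; at every later
   time it is exactly that of [b]. *)
case: (eqVneq t 0) => [->|tn0].
  apply: normalize_realization => [v||] /=.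
  - by rewrite subr0 mul1r mul0r addr0.
  - by rewrite K_sum.
  - rewrite (_ : finset.finset _ = finset.finset (fun v => coord (f (g b)) v != 0)) //.
    by apply/setP=> v; rewrite !inE subr0 mul1r mul0r addr0.
have ge0 v : 0 <= (1 - t) * coord (f (g b)) v + t * coord b v.
  by rewrite addr_ge0 // mulr_ge0 // subr_ge0.
apply: normalize_realization => //=; first by rewrite K_sum.
rewrite (_ : finset.finset _ = finset.finset (fun v => coord b v != 0)) //.
apply/setP=> v; rewrite !inE; case: (eqVneq (coord b v) 0) => [bv|bv].
  have -> : coord (f (g b)) v = 0.
    by apply/eqP; apply: contraTT isT => /(fg_support bj); rewrite bv eqxx.
  by rewrite bv !mulr0 addr0 eqxx.
rewrite gt_eqF // ltr_wpDl ?mulr_ge0 ?subr_ge0 // mulr_gt0 //.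
  by rewrite lt_neqAle eq_sym tn0.
by rewrite lt_neqAle eq_sym bv b0.
Qed.

Let continuous_f x : realization R (order_complex L) x -> {for x, continuous f}.
Proof.
move=> /realizationP xL; apply: continuous_at_normalize => [v|].
  by apply: continuous_at_to_join => A; exact: continuous_at_coord.
by rewrite (to_join_sum D xL) oner_neq0.
Qed.

Let continuous_g b : realization R join b -> {for b, continuous g}.
Proof.
move=> /realizationP bj; apply: continuous_at_normalize => [A|].
  apply: continuous_at_stair => [|v]; first exact: cst_continuous.
  exact: continuous_at_coord.
by rewrite gt_eqF // (stair_pos i0 D bj).
Qed.

(** The maps are given by formulas on the whole ambient space and are continuous there at each point
    of the subset concerned, which yields continuity within the subset. *)
Lemma join_equivalence :
  realizations_homotopy_equivalent R (order_complex L) join.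
Proof.
exists f, g, H, K; split; [split|split; split].
- exact: f_join.
- exact: g_L.
- by apply: continuous_in_subspaceT => x; rewrite inE; exact: continuous_f.
- by apply: continuous_in_subspaceT => b; rewrite inE; exact: continuous_g.
- apply: continuous_in_subspaceT => -[t x]; rewrite inE /= => -[/= t01 xL].
  have /realizationP xb := xL; apply: continuous_at_normalize => [A|].
    apply: continuous_at_deform => [|B]; first exact: cvg_fst.
    by apply: continuous_at_coord; exact: cvg_snd.
  rewrite gt_eqF // (deform_pos i0 D xb) //.
  by move: t01; rewrite /= in_itv /= => /andP[].
- move=> t x; rewrite /= in_itv /= => /andP[t0 t1] /realizationP xL.
  apply: normalize_realization => [A||]; first exact: (deform_ge0 D).
    exact: (deform_pos i0 D xL).
  exact: (deform_face i0 D xL).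
- move=> x xL; rewrite /H /g (coord_f xL); congr normalize.
  by apply/funext=> A; have /realizationP xb := xL; rewrite (deform0 _ _ _ _ xb).
- move=> x xL; rewrite /H (_ : deform o X L U cl _ _ = coord x).
    exact/normalize_coord/sum_coord_realization/xL.
  by apply/funext=> A; have /realizationP xb := xL; rewrite (deform1 D xb).
- apply: continuous_in_subspaceT => -[t b]; rewrite inE /= => -[/= t01 bj].
  have csnd : {for (t, b), continuous (fun q : R * 'rV[R]_#|{: V}| => q.2)}.
    exact: cvg_snd.
  have cfst : {for (t, b), continuous (fun q : R * 'rV[R]_#|{: V}| => q.1)}.
    exact: cvg_fst.
  apply: continuous_at_normalize => [v|]; last by rewrite K_sum ?oner_neq0.
  apply: continuous_at_add; apply: continuous_at_mul => //.
  + by apply: continuous_at_sub => //; exact: cst_continuous.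
  + apply: continuous_at_coord.
    apply: (@continuous_comp _ _ _ (fun q : R * 'rV[R]_#|{: V}| => q.2) (f \o g)) => //=.
    apply: continuous_comp; first exact: continuous_g.
    exact: continuous_f (g_L bj).
  + exact: continuous_at_coord.
- by move=> t b; rewrite /= in_itv /= => t01; exact: K_join.
- move=> b bj; rewrite /K /= -[RHS]normalize_coord; last first.
    exact: sum_coord_realization (f_join (g_L bj)).
  by congr normalize; apply/funext=> v; rewrite subr0 mul1r mul0r addr0.
- move=> b bj; rewrite /K /= -[RHS]normalize_coord; last first.
    exact: sum_coord_realization bj.
  by congr normalize; apply/funext=> v; rewrite subrr mul0r mul1r add0r.
Qed.

End JoinEquivalence.

(** * Application to the rack of p-elements *)

Theorem mainTheorem10 (R : realType) (gT : finGroupType) (G : {group gT})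
    (p : nat) :
  prime p -> p %| #|G| ->
  let X := Gp G p in
  let c := #|[set C in classes <<X>> | C \subset X]| in
  realizations_homotopy_equivalent R
    (order_complex (Rbar X))
    (simplicial_join (sphere_complex c) (order_complex (Parabolic X))).
Proof.
move=> _ _ X c.
(* The index of the class of the identity serves as [i0]. *)
exact: (join_equivalence R (class_index (Gp_norm G p) (Gp1 G p) 1%g)
  (rack_join_data (Gp_norm G p) (Gp1 G p))).
Qed.
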